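(* Let $\tilde\kappa:I\subset\mathbb R\to\mathbb R$ be a non-constant smooth function defined on an open interval $I$, such that $\tilde\kappa(z)>-1$ for any $z\in I$. Then one can construct two families of generalized $(\tilde\kappa_i,\tilde\mu_i)$-paracontact metric manifolds $(M,\tilde\varphi_i,\xi_i,\eta_i,\tilde g_i)$, $i=1,2$, in the set $M=\mathbb R^2\times I\subset\mathbb R^3$, so that for any $P=(x,y,z)\in M$ the following are valid: $$\tilde\kappa_1(P)=\tilde\kappa_2(P)=\tilde\kappa(z),\qquad \tilde\mu_1(P)=2\big(1+\sqrt{1+\tilde\kappa(z)}\big),\qquad \tilde\mu_2(P)=2\big(1-\sqrt{1+\tilde\kappa(z)}\big).$$ Each family is determined by two arbitrary smooth functions of one variable.
   Context: An almost paracontact structure on a $(2n+1)$-dimensional manifold $M$ is a triple $(\tilde\varphi,\xi,\eta)$ of a $(1,1)$-tensor field, a vector field and a 1-form with $\eta(\xi)=1$, $\tilde\varphi^2=I-\eta\otimes\xi$, and such that the $\pm1$-eigendistributions of $\tilde\varphi$ on $\ker\eta$ both have dimension $n$. It is an almost paracontact metric structure if $\tilde g$ is a pseudo-Riemannian metric with $\tilde g(\tilde\varphi X,\tilde\varphi Y)=-\tilde g(X,Y)+\eta(X)\eta(Y)$, and a paracontact metric structure if moreover $d\eta(X,Y)=\tilde g(X,\tilde\varphi Y)$, where $d\eta(X,Y)=\frac12\big(X\eta(Y)-Y\eta(X)-\eta([X,Y])\big)$. Put $\tilde h=\frac12\mathcal L_\xi\tilde\varphi$. The curvature tensor of the Levi-Civita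 connection is $\tilde R(X,Y)Z=\tilde\nabla_X\tilde\nabla_YZ-\tilde\nabla_Y\tilde\nabla_XZ-\tilde\nabla_{[X,Y]}Z$. A generalized $(\tilde\kappa,\tilde\mu)$-paracontact metric manifold is a 3-dimensional paracontact metric manifold for which there are non-constant smooth functions $\tilde\kappa,\tilde\mu$ on $M$ with $$\tilde R(X,Y)\xi=\tilde\kappa(\eta(Y)X-\eta(X)Y)+\tilde\mu(\eta(Y)\tilde hX-\eta(X)\tilde hY)$$ for all vector fields $X,Y$. *)

(* Defs.v *)
(* MathComp-Analysis, over an arbitrary [R : realType]. *)
From HB Require Import structures.
From mathcomp Require Import all_boot all_order all_algebra.
From mathcomp Require Import all_classical all_reals all_analysis.

Set Implicit Arguments.
Unset Strict Implicit.
Unset Printing Implicit Defensive.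

Import Order.TTheory GRing.Theory Num.Theory.
Import numFieldNormedType.Exports.

Local Open Scope classical_set_scope.
Local Open Scope ring_scope.

(* Manifolds are open subsets [U] of R^m (here [ 'rV[R]_m ]), with their global
   chart.  A function, vector field or tensor field on [U] is a total function on
   R^m, of which only the values on [U] matter. *)

Section Smooth.
Context {R : realType} {V W : normedModType R}.

(* For V = R^m this is the usual C^k: iterated partial derivatives of order at
   most k exist and are continuous on U. *)
Fixpoint Ck_on (k : nat) (U : set V) (f : V -> W) : Prop :=
  (forall p, U p -> {for p, continuous f}) /\
  if k is j.+1 then
    forall v : V, (forall p, U p -> derivable f p v) /\ Ck_on j U ('D_v f)
  else True.

Definition smooth_on (U : set V) (f : V -> W) : Prop := forall k, Ck_on k U f.

End Smooth.

Definition nonconstant_on {T S : Type} (U : set T) (f : T -> S) : Prop :=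
  exists p q, [/\ U p, U q & f p <> f q].

Definition vfield (R : realType) (m : nat) : Type := 'rV[R]_m -> 'rV[R]_m.

(* Tensors are matrices acting on row vectors: phi sends v to [v *m phi p], eta
   sends v to [v *m eta p], and [metric] is the Gram matrix. *)
Record paracontact_data (R : realType) (m : nat) := ParacontactData {
  phi : 'rV[R]_m -> 'M[R]_m;
  xi : vfield R m;
  eta : 'rV[R]_m -> 'cV[R]_m;
  metric : 'rV[R]_m -> 'M[R]_m
}.

Section Geometry.
Context {R : realType} {m : nat}.
Local Notation E := 'rV[R]_m.
Local Notation vf := (vfield R m).
Implicit Types (U : set E) (X Y Z : vf) (f : E -> R) (g : E -> 'M[R]_m).

Definition vderiv X f : E -> R := fun p => 'D_(X p) f p.

Definition bracket X Y : vf := fun p => 'D_(X p) Y p - 'D_(Y p) X p.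

Definition form (w : E -> 'cV[R]_m) X : E -> R := fun p => (X p *m w p) 0 0.

Definition tens (A : E -> 'M[R]_m) X : vf := fun p => X p *m A p.

Definition gprod g X Y : E -> R := fun p => (X p *m g p *m (Y p)^T) 0 0.

Definition pseudo_riemannian U g : Prop :=
  smooth_on U g /\ forall p, U p -> (g p)^T = g p /\ g p \in unitmx.

(* Note the factor 1/2. *)
Definition extd (w : E -> 'cV[R]_m) X Y : E -> R := fun p =>
  2^-1 * (vderiv X (form w Y) p - vderiv Y (form w X) p
          - form w (bracket X Y) p).

(* [(L_X A) Y = [X, A Y] - A [X, Y]] for a (1,1)-tensor field A. *)
Definition lie_tens X (A : E -> 'M[R]_m) Y : vf := fun p =>
  bracket X (tens A Y) p - tens A (bracket X Y) p.

Definition affine_connection U (D : vf -> vf -> vf) : Prop :=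
  [/\ forall X Y, smooth_on U X -> smooth_on U Y -> smooth_on U (D X Y),
      forall X X' Y, smooth_on U X -> smooth_on U X' -> smooth_on U Y ->
        forall p, U p -> D (fun q => X q + X' q) Y p = D X Y p + D X' Y p,
      forall f X Y, smooth_on U f -> smooth_on U X -> smooth_on U Y ->
        forall p, U p -> D (fun q => f q *: X q) Y p = f p *: D X Y p,
      forall X Y Y', smooth_on U X -> smooth_on U Y -> smooth_on U Y' ->
        forall p, U p -> D X (fun q => Y q + Y' q) p = D X Y p + D X Y' p &
      forall f X Y, smooth_on U f -> smooth_on U X -> smooth_on U Y ->
        forall p, U p ->
          D X (fun q => f q *: Y q) p = vderiv X f p *: Y p + f p *: D X Y p].

Definition levi_civita U g (D : vf -> vf -> vf) : Prop :=
  [/\ affine_connection U D,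
      forall X Y, smooth_on U X -> smooth_on U Y ->
        forall p, U p -> D X Y p - D Y X p = bracket X Y p &
      forall X Y Z, smooth_on U X -> smooth_on U Y -> smooth_on U Z ->
        forall p, U p ->
          vderiv Z (gprod g X Y) p = gprod g (D Z X) Y p + gprod g X (D Z Y) p].

Definition curvature (D : vf -> vf -> vf) X Y Z : vf := fun p =>
  D X (D Y Z) p - D Y (D X Z) p - D (bracket X Y) Z p.

End Geometry.

Section Paracontact.
Context {R : realType}.

(* [eigenspace A a] is the row space of the [v] with [v *m A = a *: v], and
   [kermx (eta p)] that of the [v] with [eta(v) = 0]. *)
Definition almost_paracontact (n : nat) (U : set 'rV[R]_(n.*2.+1))
    (S : paracontact_data R n.*2.+1) : Prop :=
  [/\ smooth_on U (phi S), smooth_on U (xi S), smooth_on U (eta S) &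
      forall p, U p ->
      [/\ form (eta S) (xi S) p = 1,
          forall v : 'rV[R]_(n.*2.+1),
            v *m phi S p *m phi S p = v - (v *m eta S p) 0 0 *: xi S p,
          \rank (eigenspace (phi S p) 1 :&: kermx (eta S p))%MS = n &
          \rank (eigenspace (phi S p) (-1) :&: kermx (eta S p))%MS = n]].

Definition almost_paracontact_metric (n : nat) (U : set 'rV[R]_(n.*2.+1))
    (S : paracontact_data R n.*2.+1) : Prop :=
  [/\ almost_paracontact U S,
      pseudo_riemannian U (metric S) &
      forall X Y, smooth_on U X -> smooth_on U Y -> forall p, U p ->
        gprod (metric S) (tens (phi S) X) (tens (phi S) Y) p =
        - gprod (metric S) X Y p + form (eta S) X p * form (eta S) Y p].

Definition paracontact_metric (n : nat) (U : set 'rV[R]_(n.*2.+1))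
    (S : paracontact_data R n.*2.+1) : Prop :=
  almost_paracontact_metric U S /\
  forall X Y, smooth_on U X -> smooth_on U Y -> forall p, U p ->
    extd (eta S) X Y p = gprod (metric S) X (tens (phi S) Y) p.

Definition htensor (m : nat) (S : paracontact_data R m) (X : vfield R m) :
    vfield R m := fun p => 2^-1 *: lie_tens (xi S) (phi S) X p.

(* The Levi-Civita connection of a pseudo-Riemannian metric is unique on smooth
   fields, so quantifying existentially over it is harmless. *)
Definition generalized_paracontact_metric (U : set 'rV[R]_3)
    (S : paracontact_data R 3) (kappa mu : 'rV[R]_3 -> R) : Prop :=
  [/\ @paracontact_metric 1 U S,
      smooth_on U kappa /\ nonconstant_on U kappa,
      smooth_on U mu /\ nonconstant_on U mu &
      exists2 D : vfield R 3 -> vfield R 3 -> vfield R 3,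
        levi_civita U (metric S) D &
        forall X Y, smooth_on U X -> smooth_on U Y -> forall p, U p ->
          curvature D X Y (xi S) p =
          kappa p *: (form (eta S) Y p *: X p - form (eta S) X p *: Y p)
          + mu p *: (form (eta S) Y p *: htensor S X p
                     - form (eta S) X p *: htensor S Y p)].

Definition zcoord (p : 'rV[R]_3) : R := p 0 ord_max.

(* R^2 x I inside R^3. *)
Definition slab (I : set R) : set 'rV[R]_3 := [set p | I (zcoord p)].

Definition same_data_at (m : nat) (S S' : paracontact_data R m)
    (p : 'rV[R]_m) : Prop :=
  [/\ phi S p = phi S' p, xi S p = xi S' p, eta S p = eta S' p &
      metric S p = metric S' p].

(* The structures [F f h], for f and h smooth on I, form a family determined by
   the two functions of one variable: at a point of height z they depend on
   (f, h) exactly through the two numbers f z and h z.  In particular two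
   members agree on [slab I] iff their parameters agree on I. *)
Definition determined_by_two_functions (I : set R)
    (F : (R -> R) -> (R -> R) -> paracontact_data R 3) : Prop :=
  forall f h f' h' : R -> R,
    smooth_on I f -> smooth_on I h -> smooth_on I f' -> smooth_on I h' ->
    forall p, slab I p ->
      (same_data_at (F f h) (F f' h') p <->
       f (zcoord p) = f' (zcoord p) /\ h (zcoord p) = h' (zcoord p)).

End Paracontact.

(* Main.v *)
(** On R^2 x I take the frame xi = d/dx, e1 = d/dy, e2 = a d/dx + b d/dy + d/dz
    with a = f(z) - 2 y and b = 2 l x + c y + h(z), where phi swaps e1 and e2 and
    (xi, e1, e2) is orthonormal of signature (+, +, -).  The brackets are
    [xi, e1] = 0, [xi, e2] = 2 l e1 and [e1, e2] = -2 xi + c e1, so that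
    e1 and e2 are eigenvectors of (1/2) L_xi phi for l and - l, and Koszul's formula gives the Levi-Civita
    connection in closed form.  The curvature R(X, Y) xi has the required shape with
    kappa = l^2 - 1 and mu = 2 (1 - l) exactly when l depends on z only and
    l' = - 2 l c.  Taking l = - sqrt (1 + kappa) and l = sqrt (1 + kappa) gives the
    two families, with the functions f and h free. *)
Require Import Defs.
From HB Require Import structures.
From mathcomp Require Import all_boot all_order all_algebra.
From mathcomp Require Import all_classical all_reals all_analysis.
From mathcomp Require Import ring lra.

Set Implicit Arguments.
Unset Strict Implicit.
Unset Printing Implicit Defensive.

Import Order.TTheory GRing.Theory Num.Theory.
Import numFieldNormedType.Exports.

Local Open Scope classical_set_scope.
Local Open Scope ring_scope.

(** * Linearity of the directional derivative in its direction *)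

Section DirectionalDerivative.
Context {R : realType} {V : normedModType R}.

(** Restricted to the line through [p] along [v], both sides become derivatives at 0 of one function
    of a real variable, whose differential is linear. *)
Lemma deriveZr {W : normedModType R} (f : V -> W) p k v :
  derivable f p v -> 'D_(k *: v) f p = k *: 'D_v f p.
Proof.
move=> dv; have df := (derivable1_diffP _ _).1 ((derivable1P f p v).1 dv).
pose g (h : R) := f (h *: v + p).
have gE (l : R) : 'D_(l *: v) f p = 'D_l g 0.
  rewrite /derive; suff -> : (fun h => h^-1 *: ((f \o shift p) (h *: (l *: v)) - f p))
    = (fun h => h^-1 *: ((g \o shift 0) (h *: l) - g 0)) by [].
  by apply/funext => h; rewrite /g /= addr0 scale0r add0r scalerA.
rewrite gE -[in RHS](scale1r v) gE.
rewrite (deriveE _ df) (deriveE _ df).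
by rewrite -[k in LHS]mulr1 -[k * 1]/(k *: 1) linearZ.
Qed.

Lemma is_derive_line {W : normedModType R} (f : V -> W) (q v : V) (t : R) :
  derivable f (t *: v + q) v ->
  is_derive t 1 (fun s : R => f (s *: v + q)) ('D_v f (t *: v + q)).
Proof.
have E : (fun h : R => h^-1 *: (((fun s : R => f (s *: v + q)) \o shift t) (h *: 1)
             - f (t *: v + q))) =
         (fun h : R => h^-1 *: ((f \o shift (t *: v + q)) (h *: v)
             - f (t *: v + q))).
  apply/funext => h /=; congr (_ *: (f _ - _)).
  by rewrite -[h *: 1]/(h * 1) mulr1 scalerDl addrA.
move=> df; apply: DeriveDef.
  by rewrite /derivable E.
by rewrite /derive E.
Qed.

(* By the mean value theorem in direction v, the increment quotient [q] tends to
   ['D_v f p], by continuity of ['D_v f]. *)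
Lemma deriveDr (U : set V) (f : V -> R) p u v :
  open U -> Ck_on 1 U f -> U p ->
  'D_(u + v) f p = 'D_u f p + 'D_v f p.
Proof.
move=> oU [cf df] Up.
pose q (h : R) : R := h^-1 * (f (h *: v + (h *: u + p)) - f (h *: u + p)).
have q1 : q h @[h --> 0^'] --> 'D_(u + v) f p - 'D_u f p.
  have duv := (df (u + v)).1 _ Up.
  have du := (df u).1 _ Up.
  apply: (cvg_trans _ (cvgB duv du)); apply: near_eq_cvg.
  near=> h; rewrite /q /= !fctE /= [h *: (u + v)]scalerDr.
  have E (k x : R^o) : k *: x = k * x by [].
  rewrite [h *: u + h *: v]addrC -addrA !E; ring.
(* One-sided limits suffice to compare the two values, and for h > 0 the mean value theorem applies
   on [0, h]. *)
have q2 : q h @[h --> 0^'+] --> 'D_v f p.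
  apply/cvgrPdist_le => /= e e0.
  have := (df v).2.1 _ Up.
  move=> /cvgrPdist_le /(_ _ e0) ne.
  have nU : \forall x \near p, U x by exact: open_nbhs_nbhs.
  have [r /= r0 rP] : exists2 r : R, 0 < r & forall x, `|x| < r ->
      U (p + x) /\ `|'D_v f p - 'D_v f (p + x)| <= e.
    have /nbhs_ballP[r /= r0 rP] : \forall x \near p, U x /\ `|'D_v f p - 'D_v f x| <= e.
      by apply: filterI.
    exists r => // x xr; apply: rP; rewrite -ball_normE /ball_/=.
    by rewrite opprD addNKr normrN.
  (* For h < r / [M] and 0 <= t <= h, the vector t v + h u has norm at most h (|u| + |v|), hence
     less than r. The added 1 keeps [M] positive when u and v vanish. *)
  pose M := `|u| + `|v| + 1.
  have M0 : 0 < M by rewrite /M ltr_wpDl// addr_ge0.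
  near=> h.
  have h0 : 0 < h by near: h; exact: nbhs_right_gt.
  have hr : h < r / M by near: h; apply: nbhs_right_lt; rewrite divr_gt0.
  have small t : 0 <= t <= h -> `|t *: v + h *: u| < r.
    move=> /andP[t0 th]; apply: (le_lt_trans (ler_normD _ _)).
    rewrite !normrZ (ger0_norm t0) (gtr0_norm h0).
    have : h * M < r by rewrite -ltr_pdivlMr.
    apply: le_lt_trans.
    rewrite /M !mulrDr mulr1.
    by rewrite addrC -addrA lerD2l ler_wpDr ?(ltW h0)// ler_wpM2r.
  have Ut t : 0 <= t <= h -> U (t *: v + (h *: u + p)).
    by move=> /small/rP[H _]; rewrite addrA [_ + p]addrC.
  have dl t : 0 <= t <= h -> is_derive t 1
      (fun s : R => f (s *: v + (h *: u + p))) ('D_v f (t *: v + (h *: u + p))).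
    by move=> /Ut Upt; apply: is_derive_line; exact: (df v).1.
  have [t||t th] := MVT h0 (f := fun s : R => f (s *: v + (h *: u + p)))
      (df := fun s : R => 'D_v f (s *: v + (h *: u + p))).
  - by rewrite in_itv/= => /andP[/ltW t0 /ltW th]; apply: dl; rewrite t0.
  - apply: derivable_within_continuous => t; by rewrite in_itv/= => /dl[].
  rewrite scale0r add0r subr0 /q => ->.
  rewrite mulrC mulfK ?gt_eqF//=.
  move: th; rewrite in_itv/= => /andP[/ltW t0 /ltW th].
  have tt : 0 <= t <= h by rewrite t0.
  by have := (rP _ (small t tt)).2; rewrite [p + _]addrC addrA.
have : q h @[h --> 0^'+] --> 'D_(u + v) f p - 'D_u f p.
  apply: cvg_trans q1 => A qA; apply: (@filterS _ (nbhs (0 : R)) _ _ _ _ qA).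
  by move=> y yA y0; apply: yA; rewrite gt_eqF.
move=> /cvg_unique => /(_ (@norm_hausdorff _ _) _ q2) /eqP.
by rewrite subr_eq => /eqP ->; rewrite [RHS]addrC.
Unshelve. all: by end_near. Qed.

End DirectionalDerivative.

(** * Calculus of C^k functions: closure properties and partial derivatives *)

Section CkCalculus.
Context {R : realType}.

Section Normed.
Context {V : normedModType R}.
Implicit Types (U : set V).

Lemma Ck_onW {W : normedModType R} k U (f : V -> W) :
  Ck_on k.+1 U f -> Ck_on k U f.
Proof.
elim: k f => [|k IH] f /= [cf df]; split => // v.
have [dv Dv] := df v; split=> //; exact: IH.
Qed.

Lemma Ck_on_continuous {W : normedModType R} k U (f : V -> W) p :
  Ck_on k U f -> U p -> {for p, continuous f}.
Proof. by case: k => [|k] [cf _] Up; exact: cf. Qed.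

(** Since [U] is open, agreement on it is agreement near each of its points, so limits and
    directional derivatives agree there too. *)
Lemma Ck_on_ext {W : normedModType R} k U (f g : V -> W) : open U ->
  (forall p, U p -> f p = g p) -> Ck_on k U f -> Ck_on k U g.
Proof.
move=> oU; elim: k f g => [|k IH] f g fg [cf df].
all: have nfg p : U p -> \forall q \near p, f q = g q
   by move=> Up; near=> q; apply: fg; near: q; exact: open_nbhs_nbhs.
all: have cg p : U p -> {for p, continuous g} by
  move=> Up; rewrite /prop_for/continuous_at -fg//;
    apply: cvg_trans (cf _ Up); apply: near_eq_cvg; exact: nfg.
  by split.
split=> // v; have [dv Dv] := df v; split.
  by move=> p Up; apply: near_eq_derivable (dv _ Up); exact: nfg.
apply: IH Dv => p Up; apply: near_eq_derive; exact: nfg.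
Unshelve. all: by end_near. Qed.

Lemma Ck_on_cst {W : normedModType R} k U (c : W) : Ck_on k U (fun=> c).
Proof.
elim: k c => [|k IH] c; split=> //; try by move=> *; apply: cst_continuous.
move=> v; split=> [p _|]; first exact: derivable_cst.
by rewrite (_ : 'D_v _ = fun=> 0)//; apply/funext => p; rewrite derive_cst.
Qed.

Lemma Ck_onD k U (f g : V -> R) : open U ->
  Ck_on k U f -> Ck_on k U g -> Ck_on k U (fun p => f p + g p).
Proof.
move=> oU; elim: k f g => [|k IH] f g [cf df] [cg dg]; split=> //.
1,2: by move=> p Up; apply: continuousD; [exact: cf|exact: cg].
move=> v; have [dvf Df] := df v; have [dvg Dg] := dg v; split.
  by move=> p Up; apply: derivableD; [exact: dvf|exact: dvg].
apply: (Ck_on_ext oU _ (IH _ _ Df Dg)) => p Up.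
by rewrite deriveD//; [exact: dvf|exact: dvg].
Qed.

Lemma Ck_onM k U (f g : V -> R) : open U ->
  Ck_on k U f -> Ck_on k U g -> Ck_on k U (fun p => f p * g p).
Proof.
move=> oU; elim: k f g => [|k IH] f g Cf Cg.
  by split=> // p Up; apply: continuousM; [exact: Cf.1|exact: Cg.1].
have [cf df] := Cf; have [cg dg] := Cg; split.
  by move=> p Up; apply: continuousM; [exact: cf|exact: cg].
move=> v; have [dvf Df] := df v; have [dvg Dg] := dg v; split.
  by move=> p Up; apply: derivableM; [exact: dvf|exact: dvg].
apply: (Ck_on_ext oU _ (Ck_onD oU (IH _ _ (Ck_onW Cf) Dg)
                                  (IH _ _ (Ck_onW Cg) Df))) => p Up.
by rewrite deriveM//; [exact: dvf|exact: dvg].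
Qed.

(** The derivative is - f' f^-1 f^-1, to which the induction hypothesis on f^-1 and closure under
    products apply. *)
Lemma Ck_onV k U (f : V -> R) : open U -> (forall p, U p -> f p != 0) ->
  Ck_on k U f -> Ck_on k U (fun p => (f p)^-1).
Proof.
move=> oU f0; elim: k => [|k IH] Cf.
  by split=> // p Up; apply: continuousV; [exact: f0|exact: Cf.1].
have [cf df] := Cf; split.
  by move=> p Up; apply: continuousV; [exact: f0|exact: cf].
move=> v; have [dvf Df] := df v; split.
  by move=> p Up; apply: derivableV; [exact: f0|exact: dvf].
have IHf := IH (Ck_onW Cf).
have C1 : Ck_on k U (fun=> -1 : R) by exact: Ck_on_cst.
apply: (Ck_on_ext oU _ (Ck_onM oU (Ck_onM oU C1 Df) (Ck_onM oU IHf IHf))) => p Up.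
rewrite deriveV//; [|exact: f0|exact: dvf].
rewrite -[_ *: _]/(_ * _) expr2 invfM; ring.
Qed.

(** The derivative f' (2 sqrt f)^-1 contains sqrt f again, so induction on [k] works; positivity of
    f makes the square root differentiable and the denominator nonzero. *)
Lemma Ck_on_sqrt k U (f : V -> R) : open U -> (forall p, U p -> 0 < f p) ->
  Ck_on k U f -> Ck_on k U (fun p => Num.sqrt (f p)).
Proof.
move=> oU f0; elim: k => [|k IH] Cf.
all: have csq p : U p -> {for p, continuous (fun p => Num.sqrt (f p))} by
  move=> Up; apply: continuous_comp; [exact: Cf.1|exact: sqrt_continuous].
  by split.
have [cf df] := Cf; split=> // v; have [dvf Df] := df v.
have der p : U p -> is_derive p v (fun p => Num.sqrt (f p))
     ('D_v f p * (2 * Num.sqrt (f p))^-1).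
  move=> Up.
  (* The one-variable chain rule is applied to the restriction of [f] to the line through [p] along
     [v], and the result is carried back to [p]. *)
  have d1 : is_derive (0 : R) 1 (fun h : R => f (h *: v + p)) ('D_v f p).
    have := @is_derive_line R V R f p v 0.
    by rewrite scale0r add0r; apply; exact: dvf.
  have d2 : is_derive (f (0 *: v + p)) 1 Num.sqrt (2 * Num.sqrt (f p))^-1.
    by rewrite scale0r add0r; apply: is_derive1_sqrt; exact: f0.
  have d3 := @is_derive1_comp R Num.sqrt (fun h : R => f (h *: v + p)) 0
    _ _ d2 d1.
  have dd : derivable (fun p => Num.sqrt (f p)) p v.
    by apply/derivable1P; exact: (@ex_derive _ _ _ _ _ _ _ d3).
  apply: DeriveDef => //.
  have := @is_derive_line R V R (fun p => Num.sqrt (f p)) p v 0.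
  rewrite scale0r add0r => /(_ dd)[_ <-].
  by case: d3 => _ d3; rewrite mulrC; exact: d3.
split.
  by move=> p Up; have [] := der _ Up.
have IHf := IH (Ck_onW Cf).
have h2 : Ck_on k U (fun p => (2 * Num.sqrt (f p))^-1).
  apply: Ck_onV => //; last by apply: Ck_onM => //; exact: Ck_on_cst.
  by move=> p Up; rewrite mulf_neq0 ?pnatr_eq0// gt_eqF// sqrtr_gt0 f0.
apply: (Ck_on_ext oU _ (Ck_onM oU Df h2)) => p Up.
by have [_ ->] := der _ Up.
Qed.

Lemma Ck_on_mx k U m n (f : V -> 'M[R]_(m, n)) : open U ->
  Ck_on k U f <-> forall i j, Ck_on k U (fun p => f p i j).
Proof.
move=> oU; elim: k f => [|k IH] f.
  split=> [[cf _] i j|cf]; split=> // p Up.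
    by apply: (@continuous_comp _ _ _ f (fun M : 'M[R]_(m, n) => M i j));
      [exact: cf|exact: coord_continuous].
  (* The norm of a matrix is the largest absolute value of its entries, so finitely many entrywise
     estimates give continuity. *)
  apply/cvgrPdist_le => /= e e0.
  near=> x; rewrite [leLHS]/Num.Def.normr/= mx_normrE (bigmax_le _ (ltW e0))//=.
  move=> i _; rewrite !mxE/=.
  move: i; near: x; apply: filter_forall => /= -[i j].
  by have [/(_ _ Up)/cvgrPdist_le/(_ _ e0)] := cf i j.
split=> [Cf i j|Cf].
  have [cf df] := Cf.
  split.
    by move=> p; apply: Ck_on_continuous; exact: (IH f).1 (Ck_onW Cf) i j.
  move=> v; have [dvf Df] := df v; split.
    by move=> p Up; have /derivable_mxP := dvf _ Up.
  apply: (Ck_on_ext oU _ ((IH _).1 Df i j)) => p Up.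
  by rewrite derive_mx ?mxE//; exact: dvf.
split.
  have Ckf : Ck_on k U f by apply/IH => i j; exact: Ck_onW.
  by move=> p; exact: Ck_on_continuous Ckf.
move=> v; have dvf p : U p -> derivable f p v.
  by move=> Up; apply/derivable_mxP => i j; exact: ((Cf i j).2 v).1.
split=> //; apply/IH => i j.
apply: (Ck_on_ext oU _ ((Cf i j).2 v).2) => p Up.
by rewrite derive_mx ?mxE//; exact: dvf.
Unshelve. all: by end_near. Qed.

End Normed.

Lemma is_derive_coord m n (p v : 'M[R]_(m, n)) i j :
  is_derive p v (fun q : 'M[R]_(m, n) => q i j) (v i j).
Proof.
have did : derivable (id : 'M[R]_(m, n) -> _) p v by exact: derivable_id.
have /derivable_mxP/(_ i j) d := did.
apply: DeriveDef => //.
have := @derive_mx R _ m n id p v did.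
by rewrite derive_id => /matrixP/(_ i j); rewrite !mxE.
Qed.

Lemma Ck_on_coord m n k (U : set 'M[R]_(m, n)) i j : Ck_on k U (fun q => q i j).
Proof.
case: k => [|k]; split=> //; try by move=> *; apply: coord_continuous.
move=> v; split=> [p _|]; first by have [] := is_derive_coord p v i j.
rewrite (_ : 'D_v _ = fun=> v i j); first exact: Ck_on_cst.
by apply/funext => p; have [] := is_derive_coord p v i j.
Qed.

Lemma is_derive_comp_coord n (f : R -> R) (p v : 'rV[R]_n) i :
  derivable f (p 0 i) 1 ->
  is_derive p v (fun q : 'rV[R]_n => f (q 0 i)) ('D_1 f (p 0 i) * v 0 i).
Proof.
move=> df.
have d1 : is_derive (0 : R) 1 (fun h : R => (h *: v + p) 0 i) (v 0 i).
  have := @is_derive_line R _ R (fun q : 'rV[R]_n => q 0 i) p v 0.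
  rewrite scale0r add0r; have [d ->] := is_derive_coord p v 0 i; exact.
have d2 : is_derive ((0 *: v + p) 0 i) 1 f ('D_1 f (p 0 i)).
  by rewrite scale0r add0r; exact: derivableP.
have [d3 e3] := @is_derive1_comp R f (fun h : R => (h *: v + p) 0 i) 0 _ _ d2 d1.
have dd : derivable (fun q : 'rV[R]_n => f (q 0 i)) p v by apply/derivable1P.
apply: DeriveDef => //.
have := @is_derive_line R _ R (fun q : 'rV[R]_n => f (q 0 i)) p v 0.
by rewrite scale0r add0r => /(_ dd)[_ <-]; exact: e3.
Qed.

Lemma open_coord n (I : set R) i : open I -> open [set p : 'rV[R]_n | I (p 0 i)].
Proof.
move=> oI; apply: (@open_comp _ _ (fun p : 'rV[R]_n => p 0 i)) => //.
by move=> x _; exact: coord_continuous.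
Qed.

Lemma Ck_on_comp_coord n k (I : set R) (f : R -> R) i : open I ->
  Ck_on k I f -> Ck_on k [set p : 'rV[R]_n | I (p 0 i)] (fun p => f (p 0 i)).
Proof.
move=> oI; have oU := @open_coord n I i oI.
elim: k f => [|k IH] f Cf.
all: have cfc p : [set p : 'rV[R]_n | I (p 0 i)] p ->
    {for p, continuous (fun q : 'rV[R]_n => f (q 0 i))} by
  move=> Ip; apply: (@continuous_comp _ _ _ (fun q : 'rV[R]_n => q 0 i) f);
    [exact: coord_continuous|exact: Cf.1].
  by split.
split=> // v; have [df Df] := Cf.2 1; split=> [p Ip|].
  by have [] := @is_derive_comp_coord n f p v i (df _ Ip).
apply: (Ck_on_ext oU _ (Ck_onM oU (IH _ Df) (Ck_on_cst k _ (v 0 i)))) => p Ip.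
by have [_ ->] := @is_derive_comp_coord n f p v i (df _ Ip).
Qed.

(** Follows from linearity in the direction. It separates the components of the direction, which may
    later vary with the point, from the partial derivatives. *)
Lemma derive_delta_sum m (U : set 'rV[R]_m) (f : 'rV[R]_m -> R) p v :
  open U -> Ck_on 1 U f -> U p ->
  'D_v f p = \sum_i v 0 i * 'D_(delta_mx 0 i) f p.
Proof.
move=> oU Cf Up; rewrite [in LHS](row_sum_delta v).
apply: (big_ind2 (fun (w : 'rV[R]_m) r => 'D_w f p = r)).
- by rewrite derive0.
- by move=> u _ w _ <- <-; rewrite (deriveDr _ _ oU Cf).
- by move=> i _; rewrite deriveZr//; exact: (Cf.2 _).1.
Qed.

End CkCalculus.

(** * Explicit indices in dimension three, whose values compute *)

Definition o0 : 'I_3 := Ordinal (isT : (0 < 3)%N).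
Definition o1 : 'I_3 := Ordinal (isT : (1 < 3)%N).
Definition o2 : 'I_3 := Ordinal (isT : (2 < 3)%N).

Lemma ord3_ind (P : 'I_3 -> Prop) : P o0 -> P o1 -> P o2 -> forall i, P i.
Proof.
by move=> P0 P1 P2 [[|[|[|//]]] lti]; [move: P0|move: P1|move: P2];
  congr P; exact: val_inj.
Qed.

Lemma sum_ord3 (V : nmodType) (F : 'I_3 -> V) :
  \sum_i F i = F o0 + F o1 + F o2.
Proof.
rewrite !big_ord_recl big_ord0 addr0 addrA.
by congr (F _ + F _ + F _); exact: val_inj.
Qed.

(** * Pointwise matrix identities behind the structure, its connection and its curvature *)

Section Algebra.
Context {R : realFieldType}.
Implicit Types (a b l c da db dl : R) (u w t : 'rV[R]_3).

Definition row3 x0 x1 x2 : 'rV[R]_3 := \row_j [:: x0; x1; x2]`_j.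

Definition col3 x0 x1 x2 : 'cV[R]_3 := \col_i [:: x0; x1; x2]`_i.

Definition mx33 x00 x01 x02 x10 x11 x12 x20 x21 x22 : 'M[R]_3 :=
  \matrix_(i, j) nth 0 (nth [::]
    [:: [:: x00; x01; x02]; [:: x10; x11; x12]; [:: x20; x21; x22]] i) j.

Lemma rV3P u w : u 0 o0 = w 0 o0 -> u 0 o1 = w 0 o1 -> u 0 o2 = w 0 o2 -> u = w.
Proof. by move=> H0 H1 H2; apply/rowP; exact: ord3_ind. Qed.

Definition xi0 : 'rV[R]_3 := row3 1 0 0.

(** The rows are the images of the coordinate fields: d/dy = e1 goes to e2 = (a, b, 1), and d/dz =
    e2 - a xi - b e1 goes to e1 - b e2. *)
Definition phi_mx a b := mx33 0 0 0 a b 1 (- (a * b)) (1 - b * b) (- b).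

(** Here and below, a matrix prefixed by [d] is the entrywise derivative along a direction in which
    a, b and l have derivatives [da], [db] and [dl]. *)
Definition dphi_mx a b da db :=
  mx33 0 0 0 da db 0 (- (da * b + a * db)) (- (db * b + b * db)) (- db).

(** The form dx - a dz, which is 1 on xi and vanishes on e1 and e2. *)
Definition eta_mx a := col3 1 0 (- a).

Definition deta_mx da := col3 0 0 (- da).

Definition metric_mx a b :=
  mx33 1 0 (- a) 0 1 (- b) (- a) (- b) (a * a + b * b - 1).

Definition dmetric_mx a b da db :=
  mx33 0 0 (- da) 0 0 (- db) (- da) (- db)
    (da * a + a * da + (db * b + b * db)).

(* [u0, u1, u 0 o2] and [w0, w1, w 0 o2] are the components of [u] and [w] in the
   frame (xi, e1, e2), [t0, t1, t2] those of the quadratic part of the connection;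
   the last term of each coordinate comes from differentiating the frame, [az] and
   [bz] standing for the z-derivatives of [a] and [b]. *)
Definition christoffel a b az bz l c u w : 'rV[R]_3 :=
  let u0 := u 0 o0 - a * u 0 o2 in let u1 := u 0 o1 - b * u 0 o2 in
  let w0 := w 0 o0 - a * w 0 o2 in let w1 := w 0 o1 - b * w 0 o2 in
  let t0 := (l - 1) * u1 * w 0 o2 + (l + 1) * u 0 o2 * w1 in
  let t1 := (l - 1) * u0 * w 0 o2 + c * u1 * w 0 o2 - (1 + l) * u 0 o2 * w0 in
  let t2 := (l - 1) * (u0 * w1 + u1 * w0) + c * u1 * w1 in
  row3 (t0 + a * t2 - w 0 o2 * (az * u 0 o2 - 2 * u 0 o1))
       (t1 + b * t2 - w 0 o2 * (2 * l * u 0 o0 + c * u 0 o1 + bz * u 0 o2))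
       t2.

(* The endomorphism X |-> nabla_X xi = - phi X + phi (h X). *)
Definition nabla_xi_mx a b l :=
  mx33 0 0 0
       (a * (l - 1)) (b * (l - 1)) (l - 1)
       (- (a * b * (l - 1))) (- (1 + l + b * b * (l - 1))) (- (b * (l - 1))).

Definition dnabla_xi_mx a b l da db dl :=
  mx33 0 0 0
       (da * (l - 1) + a * dl) (db * (l - 1) + b * dl) dl
       (- ((da * b + a * db) * (l - 1) + a * b * dl))
       (- (dl + ((db * b + b * db) * (l - 1) + b * b * dl)))
       (- (db * (l - 1) + b * dl)).

Definition rV3E := (mxE, sum_ord3).
Ltac rV3_ring := apply: rV3P; rewrite !rV3E /= ?rV3E /=; ring.

Lemma phi_mx_sqr a b u :
  u *m phi_mx a b *m phi_mx a b = u - (u *m eta_mx a) 0 0 *: xi0.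
Proof. rV3_ring. Qed.

Lemma eta_xi0 a : (xi0 *m eta_mx a) 0 0 = 1.
Proof. by rewrite !rV3E /=; ring. Qed.

Lemma metric_mx_phi a b u w :
  (u *m phi_mx a b *m metric_mx a b *m (w *m phi_mx a b)^T) 0 0 =
  - (u *m metric_mx a b *m w^T) 0 0 + (u *m eta_mx a) 0 0 * (w *m eta_mx a) 0 0.
Proof. rewrite !rV3E /= ?rV3E /=; ring. Qed.

Lemma metric_mx_sym a b : (metric_mx a b)^T = metric_mx a b.
Proof.
by apply/matrixP => i j; rewrite !mxE; move: i j; do 2 apply: ord3_ind => /=.
Qed.

Lemma metric_mx_unit a b : metric_mx a b \in unitmx.
Proof.
(* The inverse Gram matrix is the sum of the squares of xi and e1 minus that of e2, as the frame is
   orthonormal with e2 of norm -1. *)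
have : metric_mx a b *m mx33 (1 - a * a) (- (a * b)) (- a)
   (- (a * b)) (1 - b * b) (- b) (- a) (- b) (- 1) = 1%:M.
  apply/matrixP => i j; rewrite !rV3E; move: i j.
  by do 2 apply: ord3_ind; rewrite /= ?mulr1n ?mulr0n; ring.
by move/mulmx1_unit => [].
Qed.

Lemma rank_eigenspace_phi a b (e : R) : e = 1 \/ e = - 1 ->
  \rank (eigenspace (phi_mx a b) e :&: kermx (eta_mx a))%MS = 1%N.
Proof.
(* [w] is e2 + e e1, which phi sends to e1 + e e2 = e w because e^2 = 1. Its last coordinate is 1,
   so the factor of a multiple of [w] is read off there. *)
move=> e1; pose w := row3 a (b + e) 1.
have w0 : w != 0 by apply/eqP => /rowP/(_ o2)/eqP; rewrite !mxE/= oner_eq0.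
have sub1 : (eigenspace (phi_mx a b) e :&: kermx (eta_mx a) <= w)%MS.
  apply/rV_subP => u; rewrite sub_capmx => /andP[/eigenspaceP Hu /sub_kermxP Hk].
  apply/sub_rVP; exists (u 0 o2).
  have H1 := congr1 (fun M : 'rV[R]_3 => M 0 o2) Hu.
  have H2 := congr1 (fun M : 'M[R]_1 => M 0 0) Hk.
  move: H1 H2; rewrite !rV3E /= => H1 H2.
  by rewrite /w; case: e1 H1 => -> H1; apply: rV3P; rewrite !mxE /=; lra.
have sub2 : (w <= eigenspace (phi_mx a b) e :&: kermx (eta_mx a))%MS.
  rewrite sub_capmx; apply/andP; split.
    by rewrite /w; apply/eigenspaceP; case: e1 => ->; apply: rV3P;
      rewrite !rV3E /=; ring.
  by apply/sub_kermxP/matrixP => i j; rewrite !ord1 !rV3E /=; ring.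
have rw : \rank w = 1%N by rewrite rank_rV w0.
by rewrite -[RHS]rw; apply/eqP; rewrite eqn_leq !mxrankS.
Qed.

(** Symmetry is the vanishing of the torsion, the bracket being the antisymmetrised coordinate
    derivative. It also transfers linearity from the first argument to the second. *)
Lemma christoffel_sym a b az bz l c u w :
  christoffel a b az bz l c u w = christoffel a b az bz l c w u.
Proof. rV3_ring. Qed.

Lemma christoffelDl a b az bz l c u u' w :
  christoffel a b az bz l c (u + u') w =
  christoffel a b az bz l c u w + christoffel a b az bz l c u' w.
Proof. rV3_ring. Qed.

Lemma christoffelZl a b az bz l c k u w :
  christoffel a b az bz l c (k *: u) w = k *: christoffel a b az bz l c u w.
Proof. rV3_ring. Qed.

Lemma christoffelDr a b az bz l c u w w' :
  christoffel a b az bz l c u (w + w') =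
  christoffel a b az bz l c u w + christoffel a b az bz l c u w'.
Proof. by rewrite christoffel_sym christoffelDl !(christoffel_sym _ _ _ _ _ _ u). Qed.

Lemma christoffelZr a b az bz l c k u w :
  christoffel a b az bz l c u (k *: w) = k *: christoffel a b az bz l c u w.
Proof. by rewrite christoffel_sym christoffelZl (christoffel_sym _ _ _ _ _ _ u). Qed.

Lemma christoffel_xi0 a b az bz l c u :
  christoffel a b az bz l c u xi0 = u *m nabla_xi_mx a b l.
Proof. rV3_ring. Qed.

(* The differentials of [a] and [b] at the vector [u]. *)
Definition da_of az u := az * u 0 o2 - 2 * u 0 o1.

Definition db_of bz l c u := 2 * l * u 0 o0 + c * u 0 o1 + bz * u 0 o2.

(** What remains of metric compatibility once the terms with derivatives of the two fields are
    removed from both sides. *)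
Lemma christoffel_metric a b az bz l c t u w :
  (u *m dmetric_mx a b (da_of az t) (db_of bz l c t) *m w^T) 0 0 =
  (christoffel a b az bz l c t u *m metric_mx a b *m w^T) 0 0 +
  (u *m metric_mx a b *m (christoffel a b az bz l c t w)^T) 0 0.
Proof. rewrite !rV3E /= /da_of /db_of ?rV3E /=; ring. Qed.

(** What remains of the contact condition once derivatives of the fields cancel against the bracket.
    It rests on the coefficient - 2 of y in a. *)
Lemma deta_metric a b az u w :
  2^-1 * ((w *m deta_mx (da_of az u)) 0 0 - (u *m deta_mx (da_of az w)) 0 0) =
  (u *m metric_mx a b *m (w *m phi_mx a b)^T) 0 0.
Proof. by rewrite !rV3E /= /da_of ?rV3E /=; field. Qed.

(** For A = nabla xi the left side is (nabla_u A) w - (nabla_w A) u, which is R(u, w) xi. The factor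
    - 2 l c u_z is the differential of l, and [dphi_mx a b 0 (2 * l)] is L_xi phi, as xi a = 0 and
    xi b = 2 l. *)
Lemma curvature_xi0 a b az bz l c u w :
  w *m dnabla_xi_mx a b l (da_of az u) (db_of bz l c u) (- 2 * l * c * u 0 o2)
  - u *m dnabla_xi_mx a b l (da_of az w) (db_of bz l c w) (- 2 * l * c * w 0 o2)
  + christoffel a b az bz l c u (w *m nabla_xi_mx a b l)
  - christoffel a b az bz l c w (u *m nabla_xi_mx a b l) =
  (l * l - 1) *: ((w *m eta_mx a) 0 0 *: u - (u *m eta_mx a) 0 0 *: w) +
  (2 * (1 - l)) *:
    ((w *m eta_mx a) 0 0 *: (2^-1 *: (u *m dphi_mx a b 0 (2 * l))) -
     (u *m eta_mx a) 0 0 *: (2^-1 *: (w *m dphi_mx a b 0 (2 * l)))).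
Proof. by apply: rV3P; rewrite !rV3E /= /da_of /db_of ?rV3E /=; field. Qed.

End Algebra.

(** * Derivatives of matrix-valued functions *)

Section MatrixDerivative.
Context {R : realType} {V : normedModType R}.

(** This and the next rules are in pointwise form, so that they apply to explicit matrix entries and
    leave goals for [ring]. *)
Lemma is_derive_mulf (f g : V -> R) p v df dg :
  is_derive p v f df -> is_derive p v g dg ->
  is_derive p v (fun q => f q * g q) (df * g p + f p * dg).
Proof.
move=> Hf Hg; apply: is_derive_eq (is_deriveM Hf Hg) _.
by rewrite -![_ *: _]/(_ * _); ring.
Qed.

Lemma is_derive_addf {W : normedModType R} (f g : V -> W) p v df dg :
  is_derive p v f df -> is_derive p v g dg ->
  is_derive p v (fun q => f q + g q) (df + dg).
Proof. by move=> Hf Hg; exact: is_deriveD. Qed.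

Lemma is_derive_oppf (f : V -> R) p v df :
  is_derive p v f df -> is_derive p v (fun q => - f q) (- df).
Proof. by move=> Hf; exact: is_deriveN. Qed.

Lemma is_derive_cstf (c : R) (p v : V) : is_derive p v (fun=> c : R) 0.
Proof. exact: is_derive_cst. Qed.

Lemma is_derive_mxP m n (M : V -> 'M[R]_(m, n)) p v dM :
  is_derive p v M dM <->
  forall i j, is_derive p v (fun q => M q i j) (dM i j).
Proof.
split=> [[dv <-] i j|H].
  apply: DeriveDef; first by move/derivable_mxP : dv.
  by rewrite derive_mx// mxE.
have dv : derivable M p v.
  by apply/derivable_mxP => i j; have [] := H i j.
apply: DeriveDef => //; rewrite derive_mx//; apply/matrixP => i j.
by rewrite mxE; have [] := H i j.
Qed.

Lemma is_derive_mulmx m n l (A : V -> 'M[R]_(m, n)) (B : V -> 'M[R]_(n, l))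
    p v dA dB :
  is_derive p v A dA -> is_derive p v B dB ->
  is_derive p v (fun q => A q *m B q) (dA *m B p + A p *m dB).
Proof.
move=> /is_derive_mxP HA /is_derive_mxP HB; apply/is_derive_mxP => i j.
have E : (fun q => (A q *m B q) i j) =
         \sum_k (fun q => A q i k * B q k j).
  by apply/funext => q; rewrite mxE fct_sumE.
rewrite E !mxE -big_split/=; apply: is_derive_sum => k.
exact: is_derive_mulf.
Qed.

Lemma is_derive_trmx m n (A : V -> 'M[R]_(m, n)) p v dA :
  is_derive p v A dA -> is_derive p v (fun q => (A q)^T) dA^T.
Proof.
move=> /is_derive_mxP HA; apply/is_derive_mxP => i j.
rewrite mxE (_ : (fun q => (A q)^T i j) = (fun q => A q j i))//.
by apply/funext => q; rewrite mxE.
Qed.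

Lemma is_derive_mx33 (f00 f01 f02 f10 f11 f12 f20 f21 f22 : V -> R) p v
    d00 d01 d02 d10 d11 d12 d20 d21 d22 :
  is_derive p v f00 d00 -> is_derive p v f01 d01 -> is_derive p v f02 d02 ->
  is_derive p v f10 d10 -> is_derive p v f11 d11 -> is_derive p v f12 d12 ->
  is_derive p v f20 d20 -> is_derive p v f21 d21 -> is_derive p v f22 d22 ->
  is_derive p v (fun q => mx33 (f00 q) (f01 q) (f02 q) (f10 q) (f11 q) (f12 q)
                               (f20 q) (f21 q) (f22 q))
    (mx33 d00 d01 d02 d10 d11 d12 d20 d21 d22).
Proof.
move=> *; apply/is_derive_mxP; apply: ord3_ind; apply: ord3_ind;
  by rewrite !mxE/=; under eq_fun do rewrite !mxE/=.
Qed.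

End MatrixDerivative.

(** * Closure properties of smooth functions *)

Section SmoothClosure.
Context {R : realType} {V : normedModType R} (U : set V) (oU : open U).
Implicit Types f g : V -> R.

Lemma smooth_on_cst {W : normedModType R} (c : W) : smooth_on U (fun=> c).
Proof. by move=> k; exact: Ck_on_cst. Qed.

Lemma smooth_onD f g : smooth_on U f -> smooth_on U g ->
  smooth_on U (fun p => f p + g p).
Proof. by move=> Hf Hg k; exact: Ck_onD. Qed.

Lemma smooth_onM f g : smooth_on U f -> smooth_on U g ->
  smooth_on U (fun p => f p * g p).
Proof. by move=> Hf Hg k; exact: Ck_onM. Qed.

Lemma smooth_onN f : smooth_on U f -> smooth_on U (fun p => - f p).
Proof.
move=> Hf k; have Hc : Ck_on k U (fun=> -1 : R) by exact: Ck_on_cst.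
by apply: (Ck_on_ext oU _ (Ck_onM oU Hc (Hf k))) => p _; rewrite mulN1r.
Qed.

Lemma smooth_onV f : (forall p, U p -> f p != 0) -> smooth_on U f ->
  smooth_on U (fun p => (f p)^-1).
Proof. by move=> f0 Hf k; exact: Ck_onV. Qed.

Lemma smooth_on_sqrt f : (forall p, U p -> 0 < f p) -> smooth_on U f ->
  smooth_on U (fun p => Num.sqrt (f p)).
Proof. by move=> f0 Hf k; exact: Ck_on_sqrt. Qed.

Lemma smooth_on_derivable {W : normedModType R} (f : V -> W) p v :
  smooth_on U f -> U p -> derivable f p v.
Proof. by move=> /(_ 1%N)[_ /(_ v)[+ _]]; exact. Qed.

Lemma smooth_on_is_derive {W : normedModType R} (f : V -> W) p v :
  smooth_on U f -> U p -> is_derive p v f ('D_v f p).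
Proof. by move=> Hf Up; apply: derivableP; exact: smooth_on_derivable. Qed.

Lemma smooth_on_derive {W : normedModType R} (f : V -> W) v :
  smooth_on U f -> smooth_on U ('D_v f).
Proof. by move=> Hf k; exact: ((Hf k.+1).2 v).2. Qed.

Lemma smooth_on_mx m n (f : V -> 'M[R]_(m, n)) :
  smooth_on U f <-> forall i j, smooth_on U (fun p => f p i j).
Proof.
split=> [Hf i j k|Hf k]; first exact: ((Ck_on_mx _ _ oU).1 (Hf k)).
by apply/(Ck_on_mx _ _ oU) => i j; exact: Hf.
Qed.

Lemma smooth_on_ext {W : normedModType R} (f g : V -> W) :
  (forall p, U p -> f p = g p) -> smooth_on U f -> smooth_on U g.
Proof. by move=> fg Hf k; exact: Ck_on_ext (Hf k). Qed.

Lemma smooth_on_row3 f0 f1 f2 :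
  smooth_on U f0 -> smooth_on U f1 -> smooth_on U f2 ->
  smooth_on U (fun p => row3 (f0 p) (f1 p) (f2 p)).
Proof.
move=> *; apply/smooth_on_mx => i; apply: ord3_ind;
  by under eq_fun do rewrite !mxE/=.
Qed.

Lemma smooth_on_col3 f0 f1 f2 :
  smooth_on U f0 -> smooth_on U f1 -> smooth_on U f2 ->
  smooth_on U (fun p => col3 (f0 p) (f1 p) (f2 p)).
Proof.
move=> *; apply/smooth_on_mx; apply: ord3_ind => j;
  by under eq_fun do rewrite !mxE/=.
Qed.

Lemma smooth_on_mx33 f00 f01 f02 f10 f11 f12 f20 f21 f22 :
  smooth_on U f00 -> smooth_on U f01 -> smooth_on U f02 ->
  smooth_on U f10 -> smooth_on U f11 -> smooth_on U f12 ->
  smooth_on U f20 -> smooth_on U f21 -> smooth_on U f22 ->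
  smooth_on U (fun q => mx33 (f00 q) (f01 q) (f02 q) (f10 q) (f11 q) (f12 q)
                             (f20 q) (f21 q) (f22 q)).
Proof.
move=> *; apply/smooth_on_mx; apply: ord3_ind; apply: ord3_ind;
  by under eq_fun do rewrite !mxE/=.
Qed.

End SmoothClosure.

(** * Differentiation along smooth vector fields *)

Section VectorFields.
Context {R : realType} {m : nat} (U : set 'rV[R]_m) (oU : open U).

Lemma derive_vfieldDr n (f : 'rV[R]_m -> 'rV[R]_n) p u v :
  smooth_on U f -> U p -> 'D_(u + v) f p = 'D_u f p + 'D_v f p.
Proof.
move=> Hf Up; have df w : derivable f p w by exact: smooth_on_derivable Up.
apply/rowP => i; rewrite mxE !derive_mx// !mxE.
by apply: deriveDr oU _ Up; exact: ((smooth_on_mx oU f).1 Hf 0 i 1%N).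
Qed.

(** The direction varies with the point, so the derivative is rewritten as a finite sum of
    components of [X] times partial derivatives of [f]. *)
Lemma smooth_on_covariant n (X : 'rV[R]_m -> 'rV[R]_m) (f : 'rV[R]_m -> 'rV[R]_n) i :
  smooth_on U X -> smooth_on U f -> smooth_on U (fun p => ('D_(X p) f p) 0 i).
Proof.
move=> HX Hf; have Hfi := (smooth_on_mx oU f).1 Hf 0 i.
have HXj := (smooth_on_mx oU X).1 HX 0.
(* Summing over an arbitrary list allows induction; the list of all indices is put in at the end. *)
pose F (s : seq 'I_m) p := \sum_(j <- s) X p 0 j *
  'D_(delta_mx 0 j) (fun q => f q 0 i) p.
have HF s : smooth_on U (F s).
  rewrite /F; elim: s => [|j s IH].
    by under eq_fun do rewrite big_nil; exact: smooth_on_cst.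
  under eq_fun do rewrite big_cons.
  apply: smooth_onD => //; apply: smooth_onM => //; exact: smooth_on_derive.
apply: (smooth_on_ext oU _ (HF (index_enum 'I_m))) => p Up.
rewrite derive_mx; last exact: smooth_on_derivable Up.
by rewrite mxE (derive_delta_sum (X p) oU (Hfi 1%N) Up).
Qed.

End VectorFields.

(** * The structure defined by the frame for a nonvanishing [L], its connection and its curvature *)

Section Construction.
Context {R : realType}.
Implicit Types (L f h : R -> R) (p v : 'rV[R]_3) (X Y Z : vfield R 3).

(* With this choice of c, [l' = - 2 l c]. *)
Definition frame_c L (z : R) : R := - 'D_1 L z * (2 * L z)^-1.

Definition frame_a f p : R := f (zcoord p) + - (2 * p 0 o1).

Definition frame_b L h p : R :=
  2 * L (zcoord p) * p 0 o0 + frame_c L (zcoord p) * p 0 o1 + h (zcoord p).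

Definition frame_bz L h p : R :=
  2 * 'D_1 L (zcoord p) * p 0 o0 + 'D_1 (frame_c L) (zcoord p) * p 0 o1
  + 'D_1 h (zcoord p).

Definition frame_structure L f h : paracontact_data R 3 :=
  ParacontactData (fun p => phi_mx (frame_a f p) (frame_b L h p))
    (fun=> xi0) (fun p => eta_mx (frame_a f p))
    (fun p => metric_mx (frame_a f p) (frame_b L h p)).

Definition frame_gamma L f h p : 'rV[R]_3 -> 'rV[R]_3 -> 'rV[R]_3 :=
  christoffel (frame_a f p) (frame_b L h p) ('D_1 f (zcoord p))
    (frame_bz L h p) (L (zcoord p)) (frame_c L (zcoord p)).

Definition frame_connection L f h (X Y : vfield R 3) : vfield R 3 := fun p =>
  'D_(X p) Y p + frame_gamma L f h p (X p) (Y p).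

Lemma zcoordE p : zcoord p = p 0 o2.
Proof. by congr (p 0 _); exact: val_inj. Qed.

Lemma comp_zcoordE (g : R -> R) :
  (fun p => g (zcoord p)) = (fun p => g (p 0 o2)).
Proof. by apply/funext => p; rewrite zcoordE. Qed.

(** The entries a and - b of phi recover f z and h z, since a - f z and b - h z depend only on the
    point and on [L]. *)
Lemma frame_structure_determined L (I : set R) :
  determined_by_two_functions I (frame_structure L).
Proof.
move=> f h f' h' _ _ _ _ p _; split; last first.
  move=> [ef eh]; split; rewrite //= /frame_a /frame_b ef ?eh//.
move=> [/matrixP ephi _ _ _]; split.
  by have := ephi o1 o0; rewrite !mxE /= => /addIr.
by have := ephi o2 o2; rewrite !mxE /= => /oppr_inj /addrI.
Qed.

Variables (I : set R) (oI : open I) (L f h : R -> R).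
Hypotheses (sL : smooth_on I L) (sf : smooth_on I f) (sh : smooth_on I h).
Hypothesis L0 : forall z, I z -> L z != 0.

Local Notation U := (slab I).
Local Notation a := (frame_a f).
Local Notation b := (frame_b L h).
Local Notation S := (frame_structure L f h).
Local Notation D := (frame_connection L f h).

Let slabE : U = [set p | I (p 0 o2)].
Proof. by apply/funext => p; rewrite /slab /= zcoordE. Qed.

Let oU : open U.
Proof. by rewrite slabE; exact: open_coord. Qed.

Lemma smooth_on_zcoord (g : R -> R) :
  smooth_on I g -> smooth_on U (fun p => g (zcoord p)).
Proof.
move=> Hg k; rewrite slabE comp_zcoordE.
exact: Ck_on_comp_coord.
Qed.

Lemma is_derive_zcoord (g : R -> R) p v : smooth_on I g -> U p ->
  is_derive p v (fun q => g (zcoord q)) ('D_1 g (zcoord p) * v 0 o2).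
Proof.
move=> Hg Up; rewrite comp_zcoordE.
by rewrite zcoordE; apply: is_derive_comp_coord; rewrite -zcoordE;
  exact: (smooth_on_derivable Hg Up).
Qed.

Lemma smooth_on_frame_c : smooth_on I (frame_c L).
Proof.
apply: smooth_onM => //.
  by apply: smooth_onN => //; exact: smooth_on_derive.
apply: smooth_onV => //; last by apply: smooth_onM => //; exact: smooth_on_cst.
by move=> z Iz; rewrite mulf_neq0 ?pnatr_eq0 ?L0.
Qed.

Let sc := smooth_on_frame_c.

Ltac smooth := repeat first
  [ assumption
  | apply: smooth_on_cst
  | apply: smooth_on_zcoord
  | apply: smooth_onM
  | apply: smooth_onD
  | apply: smooth_onN
  | (move=> ?; exact: Ck_on_coord) ].

Lemma smooth_on_frame_a : smooth_on U a.
Proof. rewrite /frame_a; smooth. Qed.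

Lemma smooth_on_frame_b : smooth_on U b.
Proof. rewrite /frame_b; smooth. Qed.

Lemma smooth_on_frame_bz : smooth_on U (frame_bz L h).
Proof.
have dL : smooth_on I ('D_1 L) by exact: smooth_on_derive.
have dh : smooth_on I ('D_1 h) by exact: smooth_on_derive.
have dc : smooth_on I ('D_1 (frame_c L)) by exact: smooth_on_derive.
rewrite /frame_bz; smooth.
- exact: (smooth_on_zcoord dL).
- exact: (smooth_on_zcoord dc).
- exact: (smooth_on_zcoord dh).
Qed.

Lemma is_derive_frame_a p v : U p ->
  is_derive p v a (da_of ('D_1 f (zcoord p)) v).
Proof.
move=> Up; apply: is_derive_eq.
  apply: is_derive_addf; first exact: is_derive_zcoord.
  apply: is_derive_oppf; apply: is_derive_mulf.
  exact: is_derive_coord.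
rewrite /da_of /=; ring.
Qed.

Lemma is_derive_frame_b p v : U p -> is_derive p v b
  (db_of (frame_bz L h p) (L (zcoord p)) (frame_c L (zcoord p)) v).
Proof.
move=> Up; apply: is_derive_eq.
  apply: is_derive_addf; last exact: is_derive_zcoord.
  apply: is_derive_addf; apply: is_derive_mulf; try exact: is_derive_coord.
    by apply: is_derive_mulf; exact: is_derive_zcoord.
  exact: is_derive_zcoord.
rewrite /db_of /frame_bz /=; ring.
Qed.

(** The relation l' = - 2 l c, in the form that the curvature identity uses; it is solved for c by
    [frame_c], where [L] must not vanish. *)
Lemma is_derive_frame_L p v : U p -> is_derive p v (fun q => L (zcoord q))
  (- 2 * L (zcoord p) * frame_c L (zcoord p) * v 0 o2).
Proof.
move=> Up; apply: (is_derive_eq (is_derive_zcoord v sL Up)).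
by rewrite /frame_c; field; exact: L0.
Qed.

Lemma frame_almost_paracontact : @almost_paracontact R 1 U S.
Proof.
have sa := smooth_on_frame_a; have sb := smooth_on_frame_b.
split.
- by apply: smooth_on_mx33; smooth.
- exact: smooth_on_cst.
- by apply: smooth_on_col3; smooth.
move=> p Up; split.
- exact: eta_xi0.
- exact: phi_mx_sqr.
- by apply: rank_eigenspace_phi; left.
- by apply: rank_eigenspace_phi; right.
Qed.

Lemma frame_pseudo_riemannian : pseudo_riemannian U (metric S).
Proof.
have sa := smooth_on_frame_a; have sb := smooth_on_frame_b.
split; first by apply: smooth_on_mx33; smooth.
by move=> p _; split; [exact: (metric_mx_sym (a p) (b p))|exact: (metric_mx_unit (a p) (b p))].
Qed.

Lemma is_derive_eta p v : U p ->
  is_derive p v (Defs.eta S) (deta_mx (da_of ('D_1 f (zcoord p)) v)).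
Proof.
move=> Up; apply/is_derive_mxP; apply: ord3_ind => j; rewrite !mxE/=.
- under eq_fun do rewrite !mxE/=; exact: is_derive_cstf.
- under eq_fun do rewrite !mxE/=; exact: is_derive_cstf.
- under eq_fun do rewrite !mxE/=.
  by apply: is_derive_oppf; exact: is_derive_frame_a.
Qed.

Ltac derive_entry :=
  apply: is_derive_eq;
  first (repeat first
    [ eassumption
    | exact: is_derive_cstf
    | apply: is_derive_oppf
    | apply: is_derive_mulf
    | apply: is_derive_addf ]);
  rewrite /GRing.scale /=; ring.

Lemma is_derive_phi p v da db : is_derive p v a da -> is_derive p v b db ->
  is_derive p v (phi S) (dphi_mx (a p) (b p) da db).
Proof.
move=> Ha Hb; apply: is_derive_mx33; derive_entry.
Qed.

Lemma is_derive_metric p v da db : is_derive p v a da -> is_derive p v b db ->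
  is_derive p v (metric S) (dmetric_mx (a p) (b p) da db).
Proof.
move=> Ha Hb; apply: is_derive_mx33; derive_entry.
Qed.

Lemma is_derive_nabla_xi p v da db dl :
  is_derive p v a da -> is_derive p v b db ->
  is_derive p v (fun q => L (zcoord q)) dl ->
  is_derive p v (fun q => nabla_xi_mx (a q) (b q) (L (zcoord q)))
    (dnabla_xi_mx (a p) (b p) (L (zcoord p)) da db dl).
Proof.
move=> Ha Hb Hl; apply: is_derive_mx33; derive_entry.
Qed.

Lemma derive_form_eta Y p v : smooth_on U Y -> U p ->
  'D_v (Defs.form (Defs.eta S) Y) p = ('D_v Y p *m Defs.eta S p) 0 0 +
     (Y p *m deta_mx (da_of ('D_1 f (zcoord p)) v)) 0 0.
Proof.
move=> HY Up.
have HdY : is_derive p v Y ('D_v Y p) by exact: smooth_on_is_derive Up.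
have /is_derive_mxP/(_ 0 0)[_ ->] := is_derive_mulmx HdY (is_derive_eta v Up).
by rewrite mxE.
Qed.

Lemma frame_paracontact_metric : @paracontact_metric R 1 U S.
Proof.
split; first split.
- exact: frame_almost_paracontact.
- exact: frame_pseudo_riemannian.
- by move=> X Y _ _ p _; exact: metric_mx_phi.
move=> X Y HX HY p Up.
rewrite /extd /vderiv !derive_form_eta// /gprod /tens /=.
(* The terms in the derivatives of [X] and [Y] cancel against eta of the bracket, leaving the
   pointwise identity. *)
rewrite -(deta_metric _ _ ('D_1 f (zcoord p))) /Defs.form /bracket /=.
rewrite mulmxBl; congr (_ * _).
by rewrite [(_ - _ : 'M[R]_1) 0 0]mxE [(- _ : 'M[R]_1) 0 0]mxE; ring.
Qed.

Lemma frame_affine_connection : affine_connection U D.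
Proof.
have sa := smooth_on_frame_a; have sb := smooth_on_frame_b.
have sz := smooth_on_frame_bz.
have sLz := smooth_on_zcoord sL; have scz := smooth_on_zcoord sc.
have df : smooth_on I ('D_1 f) by exact: smooth_on_derive.
have sdf := smooth_on_zcoord df.
split.
- move=> X Y HX HY; apply/smooth_on_mx => // i j; rewrite ord1.
  under eq_fun do rewrite mxE.
  apply: smooth_onD => //; first exact: smooth_on_covariant.
  have {}HX := (smooth_on_mx oU X).1 HX 0; have {}HY := (smooth_on_mx oU Y).1 HY 0.
  have := (smooth_on_mx oU (fun p => frame_gamma L f h p (X p) (Y p))).1.
  apply; rewrite /frame_gamma /christoffel /=.
  apply: smooth_on_row3; repeat first
    [ exact: sa | exact: sb | exact: sz | exact: sLz | exact: scz | exact: sdf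
    | exact: HX | exact: HY | exact: smooth_on_cst
    | apply: smooth_onM | apply: smooth_onD | apply: smooth_onN ]; done.
- move=> X X' Y HX HX' HY p Up.
  rewrite /frame_connection /frame_gamma christoffelDl.
  by rewrite (derive_vfieldDr oU _ _ HY Up) addrACA.
- move=> k X Y Hk HX HY p Up.
  rewrite /frame_connection /frame_gamma christoffelZl scalerDr.
  by rewrite deriveZr//; exact: (smooth_on_derivable HY Up).
- move=> X Y Y' HX HY HY' p Up.
  rewrite /frame_connection /frame_gamma christoffelDr.
  have HdY : is_derive p (X p) Y ('D_(X p) Y p) by exact: smooth_on_is_derive Up.
  have HdY' : is_derive p (X p) Y' ('D_(X p) Y' p) by exact: smooth_on_is_derive Up.
  by have [_ ->] := is_derive_addf HdY HdY'; rewrite addrACA.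
move=> k X Y Hk HX HY p Up.
rewrite /frame_connection /frame_gamma christoffelZr scalerDr addrA.
congr (_ + _); apply: derive_val; apply/is_derive_mxP => i j; rewrite ord1 !mxE.
have Hd : is_derive p (X p) Y ('D_(X p) Y p) by exact: smooth_on_is_derive Up.
have /is_derive_mxP/(_ 0 j) Hdj := Hd.
under eq_fun do rewrite mxE.
by apply: is_derive_mulf => //; exact: smooth_on_is_derive Up.
Qed.

(** Torsion vanishes by [christoffel_sym]. Compatibility is the product rule for the matrix product
    defining [gprod], with [christoffel_metric] for the derivative of the Gram matrix. *)
Lemma frame_levi_civita : levi_civita U (metric S) D.
Proof.
split; first exact: frame_affine_connection.
- move=> X Y _ _ p _; rewrite /frame_connection /frame_gamma.
  by rewrite (christoffel_sym _ _ _ _ _ _ (Y p)) /bracket opprD addrACA subrr addr0.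
move=> X Y Z HX HY _ p Up.
have HdX : is_derive p (Z p) X ('D_(Z p) X p) by exact: smooth_on_is_derive Up.
have HdY : is_derive p (Z p) Y ('D_(Z p) Y p) by exact: smooth_on_is_derive Up.
have Hdg := is_derive_metric (is_derive_frame_a (Z p) Up) (is_derive_frame_b (Z p) Up).
have := is_derive_mulmx (is_derive_mulmx HdX Hdg) (is_derive_trmx HdY).
move=> /is_derive_mxP/(_ 0 0)[_ +].
rewrite /vderiv /gprod => ->.
rewrite /frame_connection /frame_gamma linearD/= !mulmxDl mulmxDr.
have := christoffel_metric (a p) (b p) ('D_1 f (zcoord p)) (frame_bz L h p)
  (L (zcoord p)) (frame_c L (zcoord p)) (Z p) (X p) (Y p).
rewrite [((_ + _ : 'M[R]_1) + _) 0 0]mxE [(_ + _ : 'M[R]_1) 0 0]mxE => ->.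
rewrite ![(_ + _ : 'M[R]_1) 0 0]mxE /=; ring.
Qed.

(** xi is constant in the chart, so only the Christoffel term survives. The equality is one of
    functions, so it can be differentiated again in the curvature. *)
Lemma frame_connection_xi Y :
  D Y (xi S) = fun q => Y q *m nabla_xi_mx (a q) (b q) (L (zcoord q)).
Proof.
apply/funext => q; rewrite /frame_connection /frame_gamma christoffel_xi0.
by rewrite derive_cst add0r.
Qed.

(** As xi is constant, [xi, .] is differentiation along xi, and the product rule leaves [X] applied
    to the derivative of phi, where a has derivative 0 and b has derivative 2 l. *)
Lemma frame_htensor X p : smooth_on U X -> U p ->
  htensor S X p =
  2^-1 *: (X p *m dphi_mx (a p) (b p) 0 (2 * L (zcoord p))).
Proof.
move=> HX Up; rewrite /htensor /lie_tens /bracket /= !derive_cst !subr0.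
congr (_ *: _).
have HdX : is_derive p xi0 X ('D_xi0 X p) by exact: smooth_on_is_derive Up.
have := is_derive_phi (is_derive_frame_a xi0 Up) (is_derive_frame_b xi0 Up).
move=> /(is_derive_mulmx HdX)[_ ->].
rewrite /tens /= derive_cst subr0 [_ + X p *m _]addrC addrK; congr (_ *m dphi_mx _ _ _ _).
  by rewrite /da_of !mxE /=; ring.
by rewrite /db_of !mxE /=; ring.
Qed.

Lemma frame_curvature X Y p : smooth_on U X -> smooth_on U Y -> U p ->
  curvature D X Y (xi S) p =
  (L (zcoord p) * L (zcoord p) - 1) *:
    (Defs.form (Defs.eta S) Y p *: X p - Defs.form (Defs.eta S) X p *: Y p)
  + (2 * (1 - L (zcoord p))) *:
    (Defs.form (Defs.eta S) Y p *: htensor S X p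
     - Defs.form (Defs.eta S) X p *: htensor S Y p).
Proof.
move=> HX HY Up; rewrite !frame_htensor//.
rewrite -(curvature_xi0 _ _ ('D_1 f (zcoord p)) (frame_bz L h p) _
  (frame_c L (zcoord p))).
rewrite /curvature !frame_connection_xi /frame_connection.
have HdA v := is_derive_nabla_xi (is_derive_frame_a v Up)
  (is_derive_frame_b v Up) (is_derive_frame_L v Up).
have HdX : is_derive p (Y p) X ('D_(Y p) X p) by exact: smooth_on_is_derive Up.
have HdY : is_derive p (X p) Y ('D_(X p) Y p) by exact: smooth_on_is_derive Up.
have [_ ->] := is_derive_mulmx HdX (HdA (Y p)).
have [_ ->] := is_derive_mulmx HdY (HdA (X p)).
rewrite /frame_gamma /bracket mulmxBl.
(* With the products abstracted, the derivatives of [X] and [Y] cancel against the bracket term by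
   linear arithmetic. *)
move: ('D_(Y p) X p *m _) ('D_(X p) Y p *m _) => A B.
move: (christoffel _ _ _ _ _ _ _ _) (christoffel _ _ _ _ _ _ _ _) => C C'.
move: (X p *m dnabla_xi_mx _ _ _ _ _ _) (Y p *m dnabla_xi_mx _ _ _ _ _ _) => E F.
by apply/rowP => i; rewrite !mxE; ring.
Qed.

(** Leaving [k] and [m] abstract lets both signs of [L] be matched with the required formulas on the
    slab. *)
Lemma frame_generalized_paracontact_metric (k m : 'rV[R]_3 -> R) :
  smooth_on U k -> nonconstant_on U k ->
  smooth_on U m -> nonconstant_on U m ->
  (forall p, U p -> k p = L (zcoord p) * L (zcoord p) - 1) ->
  (forall p, U p -> m p = 2 * (1 - L (zcoord p))) ->
  generalized_paracontact_metric U S k m.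
Proof.
move=> sk nk sm nm kE mE; split=> //; first exact: frame_paracontact_metric.
exists D; first exact: frame_levi_civita.
by move=> X Y HX HY p Up; rewrite frame_curvature// kE// mE.
Qed.

End Construction.

(** * Transport of non-constancy *)

Section Nonconstant.
Context {R : realType}.

Lemma nonconstant_on_zcoord (I : set R) (g : R -> R) : nonconstant_on I g ->
  nonconstant_on (slab I) (fun p => g (zcoord p)).
Proof.
move=> [y [z [Iy Iz gyz]]].
have cE c : zcoord (const_mx c : 'rV[R]_3) = c by rewrite /zcoord mxE.
by exists (const_mx y), (const_mx z); rewrite /slab /= !cE.
Qed.

(** [K] is a left inverse of [G] on the values of [F] over [U], so [G] cannot identify two of
    them. *)
Lemma nonconstant_on_comp {T S S' : Type} (U : set T) (F : T -> S) (G : S -> S')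
    (K : S' -> S) : (forall p, U p -> K (G (F p)) = F p) ->
  nonconstant_on U F -> nonconstant_on U (G \o F).
Proof.
move=> KG [p [q [Up Uq Fpq]]]; exists p, q; split=> // /(congr1 K).
by rewrite /= !KG.
Qed.

End Nonconstant.

(** * The two families, one for each sign of the square root *)

Theorem theorem3 (R : realType) (I : set R) (kappa : R -> R)
    (openI : open I) (intervalI : is_interval I)
    (kappa_smooth : smooth_on I kappa)
    (kappa_nonconstant : nonconstant_on I kappa)
    (kappa_gt : forall z, I z -> -1 < kappa z) :
  exists F1 F2 : (R -> R) -> (R -> R) -> paracontact_data R 3,
    [/\ determined_by_two_functions I F1,
        determined_by_two_functions I F2 &
        forall f h : R -> R, smooth_on I f -> smooth_on I h ->
          generalized_paracontact_metric (slab I) (F1 f h)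
            (fun p => kappa (zcoord p))
            (fun p => 2 * (1 + Num.sqrt (1 + kappa (zcoord p)))) /\
          generalized_paracontact_metric (slab I) (F2 f h)
            (fun p => kappa (zcoord p))
            (fun p => 2 * (1 - Num.sqrt (1 + kappa (zcoord p))))].
Proof.
pose l z := Num.sqrt (1 + kappa z).
have gt0 z : I z -> 0 < 1 + kappa z by move=> /kappa_gt; lra.
have sl : smooth_on I l.
  by apply: smooth_on_sqrt => //; apply: smooth_onD => //; exact: smooth_on_cst.
have slN : smooth_on I (fun z => - l z) by exact: smooth_onN.
have l0 z : I z -> l z != 0 by move=> /gt0 Hz; rewrite gt_eqF// sqrtr_gt0.
have lN0 z : I z -> - l z != 0 by move=> /l0; rewrite oppr_eq0.
have ll z : I z -> l z * l z = 1 + kappa z.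
  by move=> /gt0/ltW Hz; rewrite -expr2 sqr_sqrtr.
(* Since mu = 2 (1 - L), the negative root gives the first family and the positive root the
   second. *)
exists (frame_structure (fun z => - l z)), (frame_structure l).
split; [exact: frame_structure_determined..|].
have sk := smooth_on_zcoord openI kappa_smooth.
have nk := nonconstant_on_zcoord kappa_nonconstant.
move=> f h sf sh; split; apply: frame_generalized_paracontact_metric => //.
- apply: (smooth_on_zcoord openI (g := fun z => 2 * (1 + l z))).
  apply: smooth_onM => //; first exact: smooth_on_cst.
  by apply: smooth_onD => //; exact: smooth_on_cst.
(* From m = 2 (1 + s) with s^2 = 1 + k one recovers s = m / 2 - 1 and k = s^2 - 1. *)
- apply: (nonconstant_on_comp
    (G := fun k => 2 * (1 + Num.sqrt (1 + k)))
    (K := fun m => (m / 2 - 1) ^+ 2 - 1)) nk => p /ll Hp.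
  rewrite (_ : _ / 2 - 1 = l (zcoord p)); last by rewrite /l; field.
  by rewrite expr2 Hp; ring.
- by move=> p /ll Hp; rewrite mulrNN Hp; ring.
- by move=> p _; rewrite opprK.
- apply: (smooth_on_zcoord openI (g := fun z => 2 * (1 - l z))).
  apply: smooth_onM => //; first exact: smooth_on_cst.
  by apply: smooth_onD => //; exact: smooth_on_cst.
(* Here m = 2 (1 - s), so s = 1 - m / 2. *)
- apply: (nonconstant_on_comp
    (G := fun k => 2 * (1 - Num.sqrt (1 + k)))
    (K := fun m => (1 - m / 2) ^+ 2 - 1)) nk => p /ll Hp.
  rewrite (_ : 1 - _ / 2 = l (zcoord p)); last by rewrite /l; field.
  by rewrite expr2 Hp; ring.
- by move=> p /ll Hp; rewrite Hp; ring.
Qed.
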